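(* Let $A_\bullet=(A_k)_{k=0}^\infty$ be a sequence of matrices in $\mathbb{C}^{d\times d}$ and let $P,S\in\mathbb{C}^{d\times d}$ with $P\succ0$. If $\sum_{k=0}^\infty A_k=S$ in the conventional sense, then $\sum_{k=0}^\infty A_k$ is $(\mathsf{E},P)$-summable to $S$.
   Context: $P\succ0$ means $P\in\mathbb{C}^{d\times d}$ is positive definite: $x^*Px>0$ for all nonzero $x\in\mathbb{C}^d$ (so $P$ is Hermitian). A series $\sum_{k=0}^\infty B_k$ of matrices equals $S$ in the conventional sense if its partial sums $\sum_{k=0}^nB_k$ converge to $S$ as $n\to\infty$ (in any matrix norm). For $P\succ0$ and a sequence $A_\bullet$ in $\mathbb{C}^{d\times d}$, the $P$-Euler transform is $$\mathscr{E}^P_n(A_\bullet)=\sum_{k=0}^n\binom nk(I+P)^{-n-1}P^{n-k}A_k,\qquad n\ge0.$$ The series $\sum_{k=0}^\infty A_k$ is Euler summable to $S$ with respect to $P$, or $(\mathsf{E},P)$-summable to $S$, if $\sum_{n=0}^\infty\mathscr{E}^P_n(A_\bullet)=S$ in the conventional sense. *)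

(* Defs.v *)
From mathcomp Require Export all_boot all_order all_algebra.
From mathcomp Require Export complex.
From mathcomp Require Export all_classical all_reals all_analysis.

Set Implicit Arguments.
Unset Strict Implicit.
Unset Printing Implicit Defensive.

Export Order.TTheory GRing.Theory Num.Theory.
Export numFieldNormedType.Exports.

Local Open Scope classical_set_scope.
Local Open Scope ring_scope.
Local Open Scope sesquilinear_scope.

(* R[i] viewed through its numClosedFieldType structure: the topology of a
   numFieldType, hence that of matrices over it, is attached to the structure
   and not to the bare type R[i]. *)
Definition Cplx (R : realType) : numClosedFieldType := R[i]%C.

(* In a numClosedFieldType, 0 < z entails that z is real, so this condition
   forces P to be Hermitian. *)
Definition posdefmx (C : numClosedFieldType) (d : nat) (P : 'M[C]_d) : Prop :=
  forall x : 'cV[C]_d, x != 0 -> 0 < (x ^t* *m P *m x) 0 0.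

(* series B n is the sum of the n terms of index k < n. Matrices
   carry the topology of the norm max_ij |B i j|; all norms are equivalent. *)
Definition mxseries_sum (C : numClosedFieldType) (d : nat)
    (B : nat -> 'M[C]_d) (S : 'M[C]_d) : Prop :=
  series B @ \oo --> S.

(* For P positive definite 1%:M + P is invertible, so invmx is its inverse. *)
Definition euler_transform (C : numClosedFieldType) (d : nat) (P : 'M[C]_d)
    (A : nat -> 'M[C]_d) (n : nat) : 'M[C]_d :=
  \sum_(0 <= k < n.+1)
    'C(n, k)%:R *: (invmx (1%:M + P) ^+ n.+1 *m P ^+ (n - k) *m A k).

Definition euler_summable (C : numClosedFieldType) (d : nat) (P : 'M[C]_d)
    (A : nat -> 'M[C]_d) (S : 'M[C]_d) : Prop :=
  mxseries_sum (euler_transform P A) S.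

(* Main.v *)
Require Import Defs.
From mathcomp Require Import ring.

(** Put Q := (I + P)^-1, so that Q P = I - Q.  The transform then reads
      e_n = \sum_k C(n, k) (I - Q)^(n-k) Q^(k+1) A_k,
    and its partial sums are binomial averages of those of A: with
    s_j = A_0 + .. + A_(j-1),
      e_0 + .. + e_(m-1) = \sum_(j <= m) C(m, j) (I - Q)^(m-j) Q^j s_j.
    This identity ([series_euler]) holds in every ring, because Pascal's rule
    turns the increment in m into a weighted sum of the increments
    s_(j+1) - s_j.

    So it suffices that these averages preserve limits.  For a scalar weight
    0 < q < 1 this is the regularity of the classical Euler means
    ([binomial_mean_cvg]): the weights are nonnegative, have sum 1, and their
    mass leaves every fixed index as m grows.  For the matrix weight Q, positive
    definiteness makes P Hermitian, hence P = \sum_i p_i E_i with p_i > 0 and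
    orthogonal idempotents E_i of sum I ([posdefmx_spectral]).  Polynomials in
    Q are computed eigenvalue by eigenvalue ([spectral_binomial_weight]), with
    q_i = 1 / (1 + p_i) in the open unit interval, so the matrix average is
    \sum_i E_i (scalar average of weight q_i), which tends to
    \sum_i E_i S = S. *)

Set Implicit Arguments.
Unset Strict Implicit.
Unset Printing Implicit Defensive.

Local Open Scope classical_set_scope.
Local Open Scope ring_scope.
Local Open Scope sesquilinear_scope.

(** * Partial sums of the Euler transform *)

(** The probability that a binomial variable of parameters m and q equals j,
    for q in an arbitrary ring. *)
Definition binomial_weight (A : pzRingType) (q : A) (m j : nat) : A :=
  (1 - q) ^+ (m - j) * q ^+ j *+ 'C(m, j).

Lemma commr_1B (A : pzRingType) (q : A) : GRing.comm (1 - q) q.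
Proof. by rewrite /GRing.comm mulrBl mulrBr mul1r mulr1. Qed.

Lemma sum_binomial_weight (A : pzRingType) (q : A) (m : nat) :
  \sum_(j < m.+1) binomial_weight q m j = 1.
Proof. by rewrite -exprDn_comm ?subrK ?expr1n//; exact: commr_1B. Qed.

(** Averaging over m + 1 trials amounts to averaging over m trials the mean of
    the two possible outcomes of one more trial. *)
Lemma binomial_mean_rec (A : pzRingType) (q : A) (s : nat -> A) (m : nat) :
  \sum_(j < m.+2) binomial_weight q m.+1 j * s j =
  \sum_(j < m.+1) binomial_weight q m j * ((1 - q) * s j + q * s j.+1).
Proof.
have wl j : (j <= m)%N -> binomial_weight q m j * (1 - q) =
    (1 - q) ^+ (m.+1 - j) * q ^+ j *+ 'C(m, j).
  move=> jm; rewrite /binomial_weight mulrnAl -mulrA subSn// exprSr -mulrA.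
  by rewrite (commrX j (commr_1B q)).
have wr j : binomial_weight q m j * q =
    (1 - q) ^+ (m.+1 - j.+1) * q ^+ j.+1 *+ 'C(m, j).
  by rewrite /binomial_weight mulrnAl -mulrA -exprSr subSS.
(* Pascal's rule splits the left side; its two halves match the terms in
   q * s j.+1 and in (1 - q) * s j. *)
under [RHS]eq_bigr do rewrite mulrDr !mulrA.
rewrite big_split /= [RHS]addrC.
rewrite big_ord_recl.
under [X in _ + X = _]eq_bigr do
  rewrite lift0 {1}/binomial_weight binS mulrnDr mulrDl -wr.
rewrite big_split /= addrA [LHS]addrC; congr (_ + _).
rewrite big_ord_recr /= bin_small// mulr0n mul0r addr0.
rewrite [RHS]big_ord_recl /=; congr (_ + _).
  by rewrite wl// /binomial_weight !bin0.
by apply: eq_bigr => j _; rewrite wl.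
Qed.

(** By induction on m: [binomial_mean_rec] shows that the right-hand side grows
    by the average of q (s_(j+1) - s_j) = q a_j. *)
Lemma series_euler (A : pzRingType) (q : A) (a : nat -> A) (m : nat) :
  series (fun n => \sum_(k < n.+1) binomial_weight q n k * q * a k) m =
  \sum_(j < m.+1) binomial_weight q m j * series a j.
Proof.
elim: m => [|m IH].
  by rewrite /series /= big_geq// big_ord_recl big_ord0 big_geq// mulr0 addr0.
rewrite binomial_mean_rec seriesSr IH -big_split /=.
apply: eq_bigr => j _; rewrite seriesSr -mulrA -mulrDr; congr (_ * _).
by rewrite mulrDr addrA -mulrDl subrK mul1r.
Qed.

(** * Binomial averages preserve limits *)

(** The ratio and the tolerance are both real, so the archimedean property of
    the real line applies, although the order of the ambient field is only
    partial. *)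
Lemma cvg_geometric_Cplx (R : realType) (K r : Cplx R) :
  0 <= r -> r < 1 -> (fun m => K * r ^+ m) @ \oo --> (0 : Cplx R).
Proof.
move=> r0 r1; rewrite -[X in _ --> X](mulr0 K); apply: cvgMr.
have E : forall z : Cplx R, 0 <= z -> (complex.Re z)%:C%C = z.
  by move=> z z0; apply: RRe_real; exact: ger0_real.
apply/cvgr0Pnorm_lt => e e0.
set x := complex.Re r; set y := complex.Re e.
have rx : r = x%:C%C by rewrite E.
have ey : e = y%:C%C by rewrite E// ltW.
have x0 : 0 <= x by move: r0; rewrite rx lecR.
have x1 : x < 1 by move: r1; rewrite rx ltcR.
have y0 : 0 < y by move: e0; rewrite ey ltcR.
have /cvgr0Pnorm_lt/(_ _ y0) : (GRing.exp x : R^nat) @ \oo --> 0.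
  by apply: cvg_expr; rewrite ger0_norm.
apply: filterS => n /=.
rewrite !ger0_norm ?exprn_ge0// => h.
by rewrite rx ey -rmorphXn ltcR.
Qed.

(** If |l - x_j| <= e/2 for j >= J, then |l - x_j| <= e/2 + K 2^-j for all j
    and a suitable K.  The binomial theorem averages 2^-j exactly, to
    (1 - q/2)^m, so the average of the errors is at most
    e/2 + K (1 - q/2)^m. *)
Lemma binomial_mean_cvg (R : realType) (V : normedModType (Cplx R))
    (q : Cplx R) (x : nat -> V) (l : V) :
  0 < q -> q < 1 -> x @ \oo --> l ->
  (fun m => \sum_(j < m.+1) binomial_weight q m j *: x j) @ \oo --> l.
Proof.
move=> q0 q1 xl; apply/cvgrPdist_lt => e e0.
have e20 : 0 < e / 2 by rewrite divr_gt0.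
have w0 m j : 0 <= binomial_weight q m j.
  by rewrite mulrn_wge0// mulr_ge0// exprn_ge0// ?subr_ge0 ltW.
move/cvgrPdist_lt : (xl) => /(_ _ e20)[J _ HJ].
(* K 2^-j dominates each of the finitely many errors of index j < J. *)
pose K := \sum_(j < J) 2 ^+ j * `|l - x j|.
have K0 : 0 <= K by apply: sumr_ge0 => j _; rewrite mulr_ge0// exprn_ge0.
have bound j : `|l - x j| <= e / 2 + K * 2^-1 ^+ j.
  have [Jj|jJ] := leqP J j.
    by rewrite (le_trans (ltW (HJ _ Jj)))// lerDl mulr_ge0// exprn_ge0.
  rewrite -[leLHS]add0r lerD ?(ltW e20)// exprVn ler_pdivlMr ?exprn_gt0// mulrC.
  by rewrite /K (bigD1 (Ordinal jJ))//= lerDl sumr_ge0.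
have rE : 1 - q + q * 2^-1 = 1 - q * 2^-1 by field.
have r1 : 1 - q + q * 2^-1 < 1 by rewrite rE ltrBlDr ltrDl mulr_gt0.
have r0 : 0 <= 1 - q + q * 2^-1.
  by rewrite addr_ge0 ?subr_ge0 ?mulr_ge0 // ltW.
have /cvgr0Pnorm_lt/(_ _ e20) := cvg_geometric_Cplx K r0 r1.
apply: filterS => m; rewrite ger0_norm ?mulr_ge0 ?exprn_ge0// => hm.
have -> : l - \sum_(j < m.+1) binomial_weight q m j *: x j =
    \sum_(j < m.+1) binomial_weight q m j *: (l - x j).
  under [RHS]eq_bigr do rewrite scalerBr.
  by rewrite sumrB -scaler_suml sum_binomial_weight scale1r.
apply: (le_lt_trans (ler_norm_sum _ _ _)).
apply: (@le_lt_trans _ _ (\sum_(j < m.+1)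
    binomial_weight q m j * (e / 2 + K * 2^-1 ^+ j))).
  by apply: ler_sum => j _; rewrite normrZ ger0_norm ?ler_wpM2l.
under eq_bigr do rewrite mulrDr.
rewrite big_split /= -mulr_suml sum_binomial_weight mul1r.
have -> : \sum_(j < m.+1) binomial_weight q m j * (K * 2^-1 ^+ j) =
    K * (1 - q + q * 2^-1) ^+ m.
  rewrite exprDn mulr_sumr; apply: eq_bigr => j _.
  by rewrite mulrCA /binomial_weight mulrnAl exprMn mulrA.
by rewrite [ltRHS]splitr ltrD2l.
Qed.

(** * Continuity of matrix multiplication *)

Lemma mx_entry_le_norm (K : numDomainType) (m n : nat) (X : 'M[K]_(m, n)) i j :
  `|X i j| <= `|X|.
Proof.
rewrite [leRHS]/Num.norm /= mx_normE -[leLHS]nngE num_le.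
exact: (le_bigmax _ (fun ij : 'I_m * 'I_n => `|X ij.1 ij.2|%:nng) (i, j)).
Qed.

Lemma mulmxl_norm_le (K : numDomainType) (m n p : nat) (B : 'M[K]_(m, n))
    (X : 'M[K]_(n, p)) :
  `|B *m X| <= (\sum_i \sum_k `|B i k|) * `|X|.
Proof.
have S0 : 0 <= \sum_i \sum_k `|B i k| by do 2!apply: sumr_ge0 => ? _.
have [->|/mx_norm_neq0[[i j] /= ij]] := eqVneq `|B *m X| 0.
  by rewrite mulr_ge0.
rewrite [leLHS]ij mxE (le_trans (ler_norm_sum _ _ _))//.
rewrite (bigD1 i)//= mulrDl -[leLHS]addr0 lerD//; last first.
  by rewrite mulr_ge0// sumr_ge0// => ? _; rewrite sumr_ge0.
rewrite mulr_suml ler_sum// => k _.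
by rewrite normrM ler_wpM2l// mx_entry_le_norm.
Qed.

Lemma cvg_mulmxl (K : numFieldType) (m n p : nat) (B : 'M[K]_(m, n))
    (x : nat -> 'M[K]_(n, p)) (l : 'M[K]_(n, p)) :
  x @ \oo --> l -> (fun k => B *m x k) @ \oo --> B *m l.
Proof.
set C := \sum_i \sum_k `|B i k|.
have C0 : 0 <= C by do 2!apply: sumr_ge0 => ? _.
have C1 : 0 < C + 1 by rewrite ltr_wpDl.
move=> xl; apply/cvgrPdist_lt => e e0.
have eC : 0 < e / (C + 1) by rewrite divr_gt0.
move/cvgrPdist_lt : xl => /(_ _ eC); apply: filterS => k.
rewrite ltr_pdivlMr// -mulmxBr => h.
apply: le_lt_trans h; rewrite (le_trans (mulmxl_norm_le _ _))// mulrC.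
by rewrite ler_wpM2l// lerDl.
Qed.

(** * Spectral resolution of positive definite matrices *)

(** Polarization: the associated sesquilinear form f is alternating, so
    f x y = - f y x; with 'i y in place of y, semilinearity on the left gives
    f x y = f y x as well. *)
Lemma mx_quadratic_form_eq0 (C : numClosedFieldType) (d : nat) (H : 'M[C]_d) :
  (forall x : 'cV[C]_d, (x ^t* *m H *m x) 0 0 = 0) -> H = 0.
Proof.
move=> H0; pose f (x y : 'cV[C]_d) : C := (x ^t* *m H *m y) 0 0.
have fD x y z t : f (x + y) (z + t) = f x z + f x t + (f y z + f y t).
  by rewrite /f [(x + y)^T]linearD /= map_mxD !mulmxDl !mulmxDr !mxE.
have fZr c x y : f x (c *: y) = c * f x y by rewrite /f -scalemxAr mxE.
have fZl c x y : f (c *: x) y = c^* * f x y.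
  by rewrite /f [(c *: x)^T]linearZ /= map_mxZ -!scalemxAl mxE.
have anti x y : f x y + f y x = 0.
  by have := fD x y x y; rewrite /f !H0 add0r addr0 => <-.
have f0 x y : f x y = 0.
  have := anti x ('i *: y); rewrite fZr fZl conjCi mulNr -mulrBr => /eqP.
  rewrite mulf_eq0 (negPf (neq0Ci _)) /= subr_eq0 => /eqP fC.
  by have /eqP := anti x y; rewrite -fC -mulr2n mulrn_eq0 /= => /eqP.
apply/matrixP => i j; rewrite [RHS]mxE -(f0 (delta_mx i 0) (delta_mx j 0)).
by rewrite /f trmx_delta map_delta_mx -rowE -colE !mxE.
Qed.

(** P and its adjoint have conjugate quadratic forms, and that of P is real. *)
Lemma posdefmx_hermitian (C : numClosedFieldType) (d : nat) (P : 'M[C]_d) :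
  posdefmx P -> P \is hermsymmx.
Proof.
move=> Ppos; apply/is_hermitianmxP; rewrite expr0 scale1r; apply/eqP.
rewrite -subr_eq0; apply/eqP/mx_quadratic_form_eq0 => x.
have [->|x0] := eqVneq x 0; first by rewrite mulmx0 mxE.
rewrite mulmxBr mulmxBl [LHS]mxE [X in _ + X]mxE.
apply/eqP; rewrite subr_eq0; apply/eqP.
have -> : x ^t* *m P ^t* *m x = (x ^t* *m P *m x) ^t*.
  by rewrite !trmx_mul !map_mxM /= trmxCK mulmxA.
by rewrite [RHS]mxE [in RHS]mxE (CrealP (gtr0_real (Ppos _ x0))).
Qed.

(** With P = U^-1 diag(p) U and U unitary, E i is the projection onto the i-th
    column of U^-1 = U^t*, and p i is the quadratic form of P at this unit
    eigenvector, hence positive. *)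
Lemma posdefmx_spectral (C : numClosedFieldType) (d : nat) (P : 'M[C]_d) :
  posdefmx P -> exists (p : 'I_d -> C) (E : 'I_d -> 'M[C]_d),
  [/\ forall i, 0 < p i, P = \sum_i p i *: E i, \sum_i E i = 1%:M &
      forall i j, E i *m E j = if i == j then E i else 0].
Proof.
move=> Ppos; have UU := spectral_unitarymx P; have Uu := spectral_unit P.
have /hermitian_normalmx/orthomx_spectralP PE := posdefmx_hermitian Ppos.
set U := spectralmx P in UU Uu PE.
have sumE (a : 'rV[C]_d) : invmx U *m diag_mx a *m U =
    \sum_i a 0 i *: (invmx U *m delta_mx i i *m U).
  rewrite diag_mx_sum_delta mulmx_sumr mulmx_suml; apply: eq_bigr => i _.
  by rewrite -scalemxAr -scalemxAl.
exists (fun i => spectral_diag P 0 i), (fun i => invmx U *m delta_mx i i *m U).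
split=> [i|||i j].
- (* the i-th column of U^t* *)
  have v0 : U ^t* *m delta_mx i (0 : 'I_1) != 0.
    apply/eqP => /(congr1 (mulmx U)).
    rewrite -invmx_unitary// mulKVmx// mulmx0 => /matrixP/(_ i 0)/eqP.
    by rewrite !mxE !eqxx oner_eq0.
  have := Ppos _ v0.
  rewrite trmx_mul map_mxM /= trmxCK trmx_delta map_delta_mx.
  rewrite {1}PE -invmx_unitary// !mulmxA mulmxK// mulmxK//.
  by rewrite -rowE -colE !mxE eqxx mulr1n.
- by rewrite -sumE.
- have := sumE (const_mx 1).
  rewrite diag_const_mx mulmx1 mulVmx// => ->.
  by apply: eq_bigr => i _; rewrite mxE scale1r.
- rewrite !mulmxA mulmxK// -[_ *m _ *m delta_mx j j]mulmxA mul_delta_mx_cond.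
  by case: eqP => [->|_]; rewrite ?mulr1n// mulr0n mulmx0 mul0mx.
Qed.

(** The cross terms E i *m E j vanish, so combinations of orthogonal idempotents
    behave like diagonal matrices. *)
Lemma spectral_mul (K : comNzRingType) (d n : nat) (E : 'I_n -> 'M[K]_d)
    (a b : 'I_n -> K) :
  (forall i j, E i *m E j = if i == j then E i else 0) ->
  (\sum_i a i *: E i) *m (\sum_i b i *: E i) = \sum_i (a i * b i) *: E i.
Proof.
move=> EE; rewrite mulmx_suml; apply: eq_bigr => i _.
rewrite mulmx_sumr (bigD1 i)//= big1 ?addr0 => [|j ji].
  by rewrite -scalemxAl -scalemxAr EE eqxx scalerA.
by rewrite -scalemxAl -scalemxAr EE eq_sym (negbTE ji) !scaler0.
Qed.

Lemma spectral_exp (K : comNzRingType) (d n : nat) (E : 'I_n -> 'M[K]_d)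
    (a : 'I_n -> K) (m : nat) :
  (forall i j, E i *m E j = if i == j then E i else 0) ->
  \sum_i E i = 1%:M ->
  (\sum_i a i *: E i) ^+ m = \sum_i a i ^+ m *: E i.
Proof.
move=> EE E1; elim: m => [|m IH].
  by rewrite expr0 -[LHS]E1; apply: eq_bigr => i _; rewrite expr0 scale1r.
by rewrite exprS IH [LHS]spectral_mul//; apply: eq_bigr => i _; rewrite exprS.
Qed.

Lemma spectral_1B (K : comNzRingType) (d n : nat) (E : 'I_n -> 'M[K]_d)
    (a : 'I_n -> K) :
  \sum_i E i = 1%:M ->
  1 - \sum_i a i *: E i = \sum_i (1 - a i) *: E i.
Proof.
move=> E1; rewrite -[1 in LHS]E1 -sumrB; apply: eq_bigr => i _.
by rewrite scalerBl scale1r.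
Qed.

Lemma spectral_binomial_weight (K : comNzRingType) (d n : nat)
    (E : 'I_n -> 'M[K]_d) (a : 'I_n -> K) (m j : nat) :
  (forall i j, E i *m E j = if i == j then E i else 0) ->
  \sum_i E i = 1%:M ->
  binomial_weight (\sum_i a i *: E i) m j =
  \sum_i binomial_weight (a i) m j *: E i.
Proof.
move=> EE E1.
rewrite /binomial_weight spectral_1B// !spectral_exp// [_ * _]spectral_mul//.
by rewrite -sumrMnl; apply: eq_bigr => i _; rewrite scalerMnl.
Qed.

(** * Regularity of Euler summation *)

Theorem corollary3p8 (R : realType) (d : nat) (A : nat -> 'M[Cplx R]_d)
    (P S : 'M[Cplx R]_d) :
  posdefmx P -> mxseries_sum A S -> euler_summable P A S.
Proof.
move=> /posdefmx_spectral[p [E [p0 PE E1 EE]]] AS.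
have p1 i : 0 < 1 + p i by rewrite addr_gt0.
pose q i := (1 + p i)^-1.
have q0 i : 0 < q i by rewrite invr_gt0.
have q1 i : q i < 1 by rewrite invf_lt1// ltrDl.
pose Q := \sum_i q i *: E i.
have QI : Q *m (1%:M + P) = 1%:M.
  have -> : 1%:M + P = \sum_i (1 + p i) *: E i.
    rewrite PE -E1 -big_split; apply: eq_bigr => i _.
    by rewrite scalerDl scale1r.
  rewrite spectral_mul// -E1; apply: eq_bigr => i _.
  by rewrite mulVf ?scale1r// gt_eqF.
have [_ PI] := mulmx1_unit QI.
have QE : invmx (1%:M + P) = Q by rewrite -[RHS](mulmxK PI) QI mul1mx.
have QP : Q * P = 1 - Q.
  by apply/eqP; rewrite eq_sym subr_eq -[X in X == _]QI mulmxDr mulmx1 addrC.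
have QPC : GRing.comm Q P.
  rewrite /GRing.comm PE [LHS]spectral_mul// [RHS]spectral_mul//.
  by apply: eq_bigr => i _; rewrite mulrC.
have eE n : euler_transform P A n =
    \sum_(k < n.+1) binomial_weight Q n k * Q * A k.
  rewrite /euler_transform QE big_mkord; apply: eq_bigr => k _.
  have kn : (k <= n)%N by rewrite -ltnS.
  rewrite scaler_nat /binomial_weight !mulrnAl; congr (_ *+ _).
  rewrite -QP exprMn_comm// -[LHS]/(Q ^+ n.+1 * P ^+ (n - k) * A k).
  congr (_ * _).
  have PQ : GRing.comm (P ^+ (n - k)) (Q ^+ k.+1).
    exact/commrX/commr_sym/commrX.
  by rewrite -[RHS]mulrA -exprSr -[RHS]mulrA PQ mulrA -exprD addnS subnK.
(* The left factors E i come out of the average, leaving scalar weights. *)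
have uE m : series (euler_transform P A) m =
    \sum_i E i *m \sum_(j < m.+1) binomial_weight (q i) m j *: series A j.
  rewrite (funext eE) series_euler.
  under eq_bigr => j _.
    rewrite spectral_binomial_weight// [_ * _]mulmx_suml.
    under eq_bigr do rewrite -scalemxAl scalemxAr.
    over.
  by rewrite exchange_big; apply: eq_bigr => i _; rewrite mulmx_sumr.
have SE : S = \sum_i E i *m S by rewrite -mulmx_suml E1 mul1mx.
rewrite /euler_summable /mxseries_sum (funext uE) SE.
apply: cvg_big => [|i _]; first exact: add_continuous.
exact/cvg_mulmxl/binomial_mean_cvg.
Qed.
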